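(* Let $\Gamma_P$ be a finite nonempty index set with $n(\Gamma_P)$ elements, let $E_c>0$, and for each $k\in\Gamma_P$ let $a_k,b_k,\lambda_k>0$ and $U_k\ge 0$ be real numbers. For $\alpha\in\mathbb{R}$ and $k\in\Gamma_P$ define $$p_k(\alpha)=\frac{1}{b_k\lambda_k}\left(\exp\left(\frac{\alpha-U_k}{a_k}\right)-1\right).$$ Then the equation $$\sum_{k\in\Gamma_P}p_k(\alpha)=E_c$$ has a solution $\alpha$ in the interval $[\alpha_{\min},\alpha_{\max}]$, where $$\alpha_{\min}=\min_{k\in\Gamma_P}\left(U_k+a_k\log\left(1+\frac{b_k\lambda_kE_c}{n(\Gamma_P)}\right)\right),\qquad \alpha_{\max}=\max_{k\in\Gamma_P}\left(U_k+a_k\log\left(1+\frac{b_k\lambda_kE_c}{n(\Gamma_P)}\right)\right).$$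
   Context: Here $\log$ is the natural logarithm. Interpretation: $U_k$ is the total energy already received by sensor $k$, $E_c$ is the total transmission power budget, and $p_k(\alpha)$ is the value of $p_k$ determined by $U_k+a_k\log(1+b_k\lambda_kp_k)=\alpha$; no sign or upper-bound constraints are imposed on $p_k(\alpha)$ in this statement. *)

(* Defs.v *)
From HB Require Import structures.
From mathcomp Require Import all_boot all_order all_algebra.
From mathcomp Require Import reals sequences exp.

Set Implicit Arguments.
Unset Strict Implicit.
Unset Printing Implicit Defensive.

Import Order.TTheory GRing.Theory Num.Theory.
Local Open Scope ring_scope.

(* The solution p of U k + a k * ln (1 + b k * lambda k * p) = alpha; it may
   be negative. *)
Definition power (R : realType) (Gamma : finType) (a b lambda U : Gamma -> R)
    (alpha : R) (k : Gamma) : R :=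
  1 / (b k * lambda k) * (expR ((alpha - U k) / a k) - 1).

(* The total energy of sensor k, including the U k already received, when
   the budget Ec is split equally. *)
Definition equal_split_energy (R : realType) (Gamma : finType)
    (a b lambda U : Gamma -> R) (Ec : R) (k : Gamma) : R :=
  U k + a k * ln (1 + b k * lambda k * Ec / #|Gamma|%:R).

(* The element k0 witnesses that Gamma is nonempty. It only seeds the iterated
   min and max; since F k0 is itself one of the values, the results are the
   minimum and maximum of F over Gamma and do not depend on k0. *)
Definition fin_min (R : realType) (Gamma : finType) (k0 : Gamma)
    (F : Gamma -> R) : R :=
  \big[Num.min/F k0]_(k : Gamma) F k.

Definition fin_max (R : realType) (Gamma : finType) (k0 : Gamma)
    (F : Gamma -> R) : R :=
  \big[Num.max/F k0]_(k : Gamma) F k.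

(* Main.v *)
(* Each [power _ _ _ _ alpha k] is increasing in [alpha] and equals [Ec / n] at
   the equal-split energy of [k]. So every term, hence the sum, is at most its
   share at [alpha_min] and at least its share at [alpha_max]; conclude by the
   intermediate value theorem. *)
Require Import Defs.
From mathcomp Require Import all_boot all_order all_algebra.
From mathcomp Require Import reals sequences exp.
From mathcomp Require Import topology normedtype.

Import Order.TTheory GRing.Theory Num.Theory.
Import numFieldNormedType.Exports.
Local Open Scope ring_scope.

Lemma le_power (R : realType) (Gamma : finType) (a b lambda U : Gamma -> R)
    (k : Gamma) :
  0 < a k -> 0 < b k -> 0 < lambda k ->
  {homo (fun alpha => power a b lambda U alpha k) : x y / x <= y}.
Proof.
move=> ak bk lk x y xy; rewrite /power ler_wpM2l //.
  by rewrite divr_ge0 // ltW // mulr_gt0.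
by rewrite lerD2r ler_expR ler_wpM2r ?lerD2r // invr_ge0 ltW.
Qed.

(** At this level the exponent reduces to [ln (1 + b k * lambda k * Ec / n)], with [n] the cardinal
    of [Gamma], and [expR] cancels [ln]. *)
Lemma power_equal_split_energy (R : realType) (Gamma : finType)
    (a b lambda U : Gamma -> R) (Ec : R) (k : Gamma) :
  0 < a k -> 0 < b k -> 0 < lambda k -> 0 <= Ec ->
  power a b lambda U (equal_split_energy a b lambda U Ec k) k
    = Ec / #|Gamma|%:R.
Proof.
move=> ak bk lk Ec0; rewrite /power /equal_split_energy addrAC subrr add0r.
have blk : 0 < b k * lambda k by rewrite mulr_gt0.
rewrite [a k * _]mulrC mulfK ?gt_eqF // lnK; last first.
  (* [lnK] requires a positive argument; here it is [1] plus a nonnegative term, since [0 <= Ec]. *)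
  by rewrite posrE ltr_pwDl // divr_ge0 // mulr_ge0 // ltW.
by rewrite addrAC subrr add0r mul1r -mulrA mulKf // gt_eqF.
Qed.

Lemma continuous_power (R : realType) (Gamma : finType)
    (a b lambda U : Gamma -> R) (k : Gamma) :
  continuous (fun alpha => power a b lambda U alpha k).
Proof.
move=> x; rewrite /power; apply: cvgM; first exact: cvg_cst.
apply: cvgB; last exact: cvg_cst.
apply: continuous_comp; last exact: continuous_expR.
by apply: cvgM; [apply: cvgB; [exact: cvg_id | exact: cvg_cst] | exact: cvg_cst].
Qed.

Theorem lemma1 (R : realType) (Gamma : finType) (k0 : Gamma) (Ec : R)
    (a b lambda U : Gamma -> R)
    (hEc : 0 < Ec)
    (ha : forall k, 0 < a k) (hb : forall k, 0 < b k)
    (hlambda : forall k, 0 < lambda k) (hU : forall k, 0 <= U k) :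
  let alpha_min := fin_min k0 (equal_split_energy a b lambda U Ec) in
  let alpha_max := fin_max k0 (equal_split_energy a b lambda U Ec) in
  exists alpha : R,
    alpha_min <= alpha <= alpha_max /\
    \sum_(k : Gamma) power a b lambda U alpha k = Ec.
Proof.
move=> alpha_min alpha_max.
have min_le_energy k : alpha_min <= equal_split_energy a b lambda U Ec k.
  exact: bigmin_le_cond.
have energy_le_max k : equal_split_energy a b lambda U Ec k <= alpha_max.
  exact: le_bigmax_cond.
have sum_share : \sum_(k : Gamma) Ec / #|Gamma|%:R = Ec.
  (* The element [k0] makes the number of shares nonzero. *)
  have n0 : #|Gamma|%:R != 0 :> R.
    by rewrite pnatr_eq0 -lt0n; apply/card_gt0P; exists k0.
  by rewrite sumr_const -[LHS]mulr_natr divfK.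
have sum_min : \sum_(k : Gamma) power a b lambda U alpha_min k <= Ec.
  rewrite -[leRHS]sum_share; apply: ler_sum => k _.
  (* Read backwards, the lemma turns the share into the power of [k] at its own equal-split energy,
     so both sides are values of one monotone function. *)
  rewrite -(@power_equal_split_energy _ _ a b lambda U _ k) ?(ltW hEc) //.
  exact: le_power.
have sum_max : Ec <= \sum_(k : Gamma) power a b lambda U alpha_max k.
  rewrite -[leLHS]sum_share; apply: ler_sum => k _.
  rewrite -(@power_equal_split_energy _ _ a b lambda U _ k) ?(ltW hEc) //.
  exact: le_power.
have [|||alpha] := @IVT R (fun x => \sum_(k : Gamma) power a b lambda U x k)
  alpha_min alpha_max Ec.
- exact: le_trans (min_le_energy k0) (energy_le_max k0).
(* [IVT] asks for continuity on the closed interval only; it is inherited from the whole line. *)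
- apply: continuous_subspaceT; apply: continuous_big => [|k _].
    exact: add_continuous.
  exact: continuous_power.
(* [IVT] wants [Ec] between the [Num.min] and [Num.max] of the two endpoint sums. *)
- by rewrite ge_min sum_min le_max sum_max orbT.
by rewrite in_itv /= => alphaI <-; exists alpha.
Qed.
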